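(* Let $\mathcal{K} = \mathcal{K}^1\times \mathcal{K}^2$, where $\mathcal{K}^1\subseteq \mathbb{R}^{n_1}$, $\mathcal{K}^2 \subseteq \mathbb{R}^{n_2}$ are closed convex cones such that $\mathcal{K}^2$ is polyhedral. (i) If $\theta_P$ is finite and (P) satisfies the PPS condition, then $\theta_P = \theta_D$ and the dual optimal value is attained. (ii) If $\theta_D$ is finite and (D) satisfies the PPS condition, then $\theta_P = \theta_D$ and the primal optimal value is attained.
   Context: Let $n=n_1+n_2$, $\mathcal{A}:\mathbb{R}^n\to\mathbb{R}^m$ linear with adjoint $\mathcal{A}^*$, $b\in\mathbb{R}^m$, $c\in\mathbb{R}^n$; a star on a cone denotes the dual cone, $\mathrm{ri}$ the relative interior. (P) is $\inf\{\langle c,x\rangle : \mathcal{A}x=b,\ x\in\mathcal{K}^*\}$ with optimal value $\theta_P$ ($+\infty$ if infeasible), and (D) is $\sup\{\langle b,y\rangle : c-\mathcal{A}^*y\in\mathcal{K}\}$ with optimal value $\theta_D$ ($-\infty$ if infeasible). Partial Polyhedral Slater's (PPS) condition: (D) satisfies it if there is a slack $(s_1,s_2)=c-\mathcal{A}^*y$ with $s_1\in\mathrm{ri}\,\mathcal{K}^1$ and $s_2\in\mathcal{K}^2$; (P) satisfies it if there is a primal feasible solution $x=(x_1,x_2)$ with $x_1\in\mathrm{ri}\,(\mathcal{K}^1)^*$. *)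

(* Defs.v *)
From HB Require Import structures.
From mathcomp Require Import all_boot all_order all_algebra.
From mathcomp Require Import all_classical all_reals all_analysis.
Import Order.TTheory GRing.Theory Num.Theory.
Import numFieldNormedType.Exports.

Set Implicit Arguments.
Unset Strict Implicit.
Unset Printing Implicit Defensive.

Local Open Scope classical_set_scope.
Local Open Scope ring_scope.

Section Euclidean.
Context {R : realType}.

Definition dot n (u v : 'cV[R]_n) : R := \sum_(i < n) u i 0 * v i 0.

Definition is_adjoint n m (A : 'cV[R]_n -> 'cV[R]_m)
    (Astar : 'cV[R]_m -> 'cV[R]_n) : Prop :=
  forall x y, dot (A x) y = dot x (Astar y).

(* Nonemptiness, and hence [0 \in K], is part of the notion of a cone. *)
Definition cone n (K : set 'cV[R]_n) : Prop :=
  K !=set0 /\ (forall (t : R) x, 0 <= t -> K x -> K (t *: x)).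

Definition closed_convex_cone n (K : set 'cV[R]_n) : Prop :=
  [/\ cone K, convex_set K & closed K].

Definition polyhedral n (K : set 'cV[R]_n) : Prop :=
  exists (k : nat) (B : 'M[R]_(k, n)) (d : 'cV[R]_k),
    K = [set x | forall i, (B *m x) i 0 <= d i 0].

Definition dual_cone n (K : set 'cV[R]_n) : set 'cV[R]_n :=
  [set s | forall x, K x -> 0 <= dot s x].

Definition affine_set n (L : set 'cV[R]_n) : Prop :=
  forall (t : R) x y, L x -> L y -> L ((1 - t) *: x + t *: y).

Definition affine_hull n (C : set 'cV[R]_n) : set 'cV[R]_n :=
  smallest (@affine_set n) C.

Definition ri n (C : set 'cV[R]_n) : set 'cV[R]_n :=
  [set x | C x /\ \forall y \near x, affine_hull C y -> C y].

Definition cone_prod n1 n2 (K1 : set 'cV[R]_n1) (K2 : set 'cV[R]_n2) :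
    set 'cV[R]_(n1 + n2) :=
  [set x | K1 (usubmx x) /\ K2 (dsubmx x)].

Section Problems.
Variables (n m : nat).
Variables (A : 'cV[R]_n -> 'cV[R]_m) (Astar : 'cV[R]_m -> 'cV[R]_n).
Variables (b : 'cV[R]_m) (c : 'cV[R]_n) (K : set 'cV[R]_n).

Definition primal_feasible : set 'cV[R]_n :=
  [set x | A x = b /\ dual_cone K x].

Definition dual_feasible : set 'cV[R]_m := [set y | K (c - Astar y)].

(* [ereal_inf set0 = +oo] and [ereal_sup set0 = -oo] give the conventional
   values of infeasible problems. *)
Definition thetaP : \bar R :=
  ereal_inf [set (dot c x)%:E | x in primal_feasible].

Definition thetaD : \bar R :=
  ereal_sup [set (dot b y)%:E | y in dual_feasible].

Definition primal_attained : Prop :=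
  exists2 x, primal_feasible x & (dot c x)%:E = thetaP.

Definition dual_attained : Prop :=
  exists2 y, dual_feasible y & (dot b y)%:E = thetaD.

End Problems.

Section PPS.
Variables (n1 n2 m : nat).
Variables (A : 'cV[R]_(n1 + n2) -> 'cV[R]_m).
Variables (Astar : 'cV[R]_m -> 'cV[R]_(n1 + n2)).
Variables (b : 'cV[R]_m) (c : 'cV[R]_(n1 + n2)).
Variables (K1 : set 'cV[R]_n1) (K2 : set 'cV[R]_n2).

Definition primal_PPS : Prop :=
  exists2 x, primal_feasible A b (cone_prod K1 K2) x
           & ri (dual_cone K1) (usubmx x).

Definition dual_PPS : Prop :=
  exists y, ri K1 (usubmx (c - Astar y)) /\ K2 (dsubmx (c - Astar y)).

End PPS.

End Euclidean.

(* Main.v *)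
(* A partially strict inequality system (a cone constraint with a Slater
   point and finitely many linear inequalities) has Lagrange multipliers.
   With no inequality this is M. Riesz's extension of a positive functional,
   one dimension at a time. Inequalities are added by Bartl's induction for
   Farkas' lemma: if [a_0] is not redundant, some [x1] satisfies the other
   constraints with [a_0 x1 = 1] and [f x1 > 0]; projecting along [x1] onto
   the kernel of [a_0] removes that inequality, and preserves the Slater
   point since it adds to it a nonnegative multiple of [x1]. (ii) is the
   case of the variable [y]; for (i) the polyhedral part of [x] is written
   [- B^T u] with [u >= 0], and the multiplier in the bidual of [K1] lies in
   [K1]. *)
Require Import Defs.
From HB Require Import structures.
From mathcomp Require Import all_boot all_order all_algebra.
From mathcomp Require Import all_classical all_reals all_analysis.
From mathcomp Require Import lra.
Import Order.TTheory GRing.Theory Num.Theory.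
Import numFieldNormedType.Exports.
Local Open Scope classical_set_scope.
Local Open Scope ring_scope.
Set Implicit Arguments.
Unset Strict Implicit.
Unset Printing Implicit Defensive.

(** * The inner product of column vectors *)

Section Dot.
Context {R : realType}.

Lemma dotC n (u v : 'cV[R]_n) : dot u v = dot v u.
Proof. by apply: eq_bigr => i _; rewrite mulrC. Qed.

Lemma dot_scalar n (u : 'cV[R]_n) : scalar (dot u).
Proof.
move=> t x y; rewrite /dot mulr_sumr -big_split; apply: eq_bigr => i _ /=.
by rewrite !mxE mulrDr mulrCA.
Qed.

HB.instance Definition _ n (u : 'cV[R]_n) :=
  GRing.isLinear.Build R 'cV[R]_n R *%R (dot u) (@dot_scalar n u).

Lemma dotDl n (u v w : 'cV[R]_n) : dot (u + v) w = dot u w + dot v w.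
Proof. by rewrite dotC linearD /= !(dotC w). Qed.

Lemma dotNl n (u w : 'cV[R]_n) : dot (- u) w = - dot u w.
Proof. by rewrite dotC linearN /= (dotC w). Qed.

Lemma dot_mulmx k n (B : 'M[R]_(k, n)) (u : 'cV[R]_k) (x : 'cV[R]_n) :
  dot (B^T *m u) x = dot u (B *m x).
Proof.
have dotE p (v w : 'cV[R]_p) : dot v w = (v^T *m w) 0 0.
  by rewrite mxE; apply: eq_bigr => i _; rewrite mxE.
by rewrite !dotE trmx_mul trmxK mulmxA.
Qed.

Lemma dot_col_mx p q (u : 'cV[R]_p) (v : 'cV[R]_q) (z : 'cV[R]_(p + q)) :
  dot (col_mx u v) z = dot u (usubmx z) + dot v (dsubmx z).
Proof.
by rewrite /dot big_split_ord /=; congr (_ + _); apply: eq_bigr => i _;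
  rewrite ?col_mxEu ?col_mxEd mxE.
Qed.

Lemma dot_delta n (u : 'cV[R]_n) i : dot u (delta_mx i 0) = u i 0.
Proof.
rewrite /dot (bigD1 i) //= mxE !eqxx mulr1 big1 ?addr0 // => j ji.
by rewrite mxE (negbTE ji) mulr0.
Qed.

Lemma dot_inj n (u v : 'cV[R]_n) : (forall x, dot u x = dot v x) -> u = v.
Proof.
by move=> uv; apply/matrixP => i j; rewrite ord1 -!dot_delta uv.
Qed.

End Dot.

(** * Convex cones and an algebraic form of the relative interior *)

Section ConvexCones.
Context {R : realType}.

Definition convex_cone (U : lmodType R) (K : set U) : Prop :=
  [/\ K 0, forall (t : R) x, 0 <= t -> K x -> K (t *: x)
    & forall x y, K x -> K y -> K (x + y)].

(* For a convex cone this is the algebraic form of the relative interior. *)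
Definition core (U : lmodType R) (K : set U) : set U :=
  [set p | K p /\ forall k, K k -> exists2 e : R, 0 < e & K (p - e *: k)].

(** The sum of two points is twice their midpoint. *)
Lemma closed_convex_coneW n (K : set 'cV[R]_n) :
  closed_convex_cone K -> convex_cone K.
Proof.
move=> [[[x0 Kx0] KZ] cK _]; split=> // [|x y Kx Ky].
  by rewrite -(scale0r x0); apply: KZ.
have h0 : 0 <= 2^-1 :> R by lra.
have h1 : 2^-1 <= 1 :> R by lra.
have /set_mem := cK x y (Itv01 h0 h1)
  (mem_set Kx) (mem_set Ky).
move=> /(KZ 2 _ (ler0n _ _)).
rewrite -[conv _ _ _]/(2^-1 *: x + (1 - 2^-1) *: y) scalerDr !scalerA.
have -> : 2 * (1 - 2^-1) = 1 :> R by lra.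
by rewrite divff ?pnatr_eq0 // !scale1r.
Qed.

Lemma dual_convex_cone n (K : set 'cV[R]_n) : convex_cone (dual_cone K).
Proof.
split=> [x _|t x t0 Kx y Ky|x y Kx Ky z Kz].
- by rewrite dotC linear0.
- by rewrite dotC linearZ /= dotC mulr_ge0 ?Kx.
- by rewrite dotDl addr_ge0 ?Kx ?Ky.
Qed.

Lemma cone_prod_convex n1 n2 (K1 : set 'cV[R]_n1) (K2 : set 'cV[R]_n2) :
  convex_cone K1 -> convex_cone K2 -> convex_cone (cone_prod K1 K2).
Proof.
move=> [z1 Z1 D1] [z2 Z2 D2]; split=> [|t x t0 [x1 x2]|x y [x1 x2] [y1 y2]].
- by split; rewrite linear0.
- by split; rewrite linearZ; [apply: Z1|apply: Z2].
- by split; rewrite linearD; [apply: D1|apply: D2].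
Qed.

Lemma core_addr (U : lmodType R) (K : set U) p k :
  convex_cone K -> core K p -> K k -> core K (p + k).
Proof.
move=> [_ _ KD] [Kp cp] Kk; split=> [|l /cp [e e0 Ke]]; first exact: KD.
by exists e; rewrite // addrAC; apply: KD.
Qed.

(** [p - e k] lies on the line through [p] and [p + k], hence in the affine hull of [K], and it is
    close to [p] for small [e]. *)
Lemma ri_core n (K : set 'cV[R]_n) :
  convex_cone K -> ri K `<=` core K.
Proof.
move=> [_ _ KD] p [Kp /nbhs_normP [d /= d0 nearK]]; split=> // k Kk.
(* This choice makes [e |k| < d]; the added 1 covers [k = 0]. *)
pose e := d / (`|k| + 1).
have k1 : 0 < `|k| + 1 by apply: ltr_wpDl.
have e0 : 0 < e by rewrite divr_gt0.
exists e => //; apply: nearK.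
  rewrite /= opprB addrC subrK normrZ gtr0_norm // /e -mulrA.
  by rewrite -ltr_pdivlMl // mulVf ?gt_eqF // mulrC ltr_pdivrMr // mul1r ltrDl.
move=> L [affL KL].
have -> : p - e *: k = (1 - - e) *: p + (- e) *: (p + k).
  by rewrite opprK scalerDl scale1r scalerDr addrA !scaleNr addrK.
by apply: affL; apply: KL => //; apply: KD.
Qed.

(** Equations enter the multiplier theorems through the cone [[set 0]], which offers no direction to
    move in, so a core point of [K1] suffices. *)
Lemma core_cone_prod_set0 n1 n2 (K1 : set 'cV[R]_n1) (x : 'cV[R]_(n1 + n2)) :
  core K1 (usubmx x) -> dsubmx x = 0 -> core (cone_prod K1 [set 0]) x.
Proof.
move=> [K1x cx] x2; split=> // k [/cx [e e0 Ke] /= k2]; exists e => //.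
by split; rewrite /= linearB linearZ ?k2 //= x2 k2 scaler0 subr0.
Qed.

End ConvexCones.

(** * Extension of positive functionals and the bipolar theorem *)

Section PositiveExtension.
Context {R : realType}.

(* A linear functional on a subspace is represented by its graph. *)
Definition linear_graph (U : lmodType R) (D : U -> R -> Prop) : Prop :=
  forall t u r v q, D u r -> D v q -> D (t *: u + v) (t * r + q).

Lemma linear_graph0 (U : lmodType R) (D : U -> R -> Prop) p q :
  linear_graph D -> D p q -> D 0 0.
Proof.
move=> linD Dp; have := linD (-1) _ _ _ _ Dp Dp.
by rewrite scaleN1r mulN1r !addNr.
Qed.

Definition pos_graph (U : lmodType R) (K : set U) (D : U -> R -> Prop) : Prop :=
  forall u r, D u r -> K u -> 0 <= r.

(** The vector [e] may already lie in the domain. Single-valuedness is recovered from positivity: a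
    value over 0 and its opposite are both nonnegative. *)
Definition extend_graph (U : lmodType R) (D : U -> R -> Prop) (e : U) (c : R)
  : U -> R -> Prop :=
  fun u r => exists t v s, [/\ D v s, u = v + t *: e & r = s + t * c].

Lemma extend_graph_linear (U : lmodType R) (D : U -> R -> Prop) e c :
  linear_graph D -> linear_graph (extend_graph D e c).
Proof.
move=> linD t u r v q [a [u' [r' [Du -> ->]]]] [b [v' [q' [Dv -> ->]]]].
exists (t * a + b), (t *: u' + v'), (t * r' + q'); split; first exact: linD.
- by rewrite scalerDr scalerDl scalerA addrACA.
- by rewrite mulrDr mulrDl mulrA addrACA.
Qed.

(** The value [c] at [e] must be at least [- r] when [u + e] is in [K], and at most [s] when [v - e]
    is in [K]. These bounds are compatible: the sum [u + v] is then in [K], so [r + s >= 0]. *)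
Lemma extend_graph_pos (U : lmodType R) (K : set U) (D : U -> R -> Prop) p q e :
  convex_cone K -> linear_graph D -> pos_graph K D -> D p q -> core K p ->
  exists c, pos_graph K (extend_graph D e c).
Proof.
move=> [K0 KZ KD] linD posD Dp [Kp cp].
have D0 := linear_graph0 linD Dp.
have DZ t u r : D u r -> D (t *: u) (t * r).
  by move=> Du; have := linD t _ _ _ _ Du D0; rewrite !addr0.
have DD u r v s : D u r -> D v s -> D (u + v) (r + s).
  by move=> Du Dv; have := linD 1 _ _ _ _ Du Dv; rewrite scale1r mul1r.
(* The core point makes the bounds on [c] from both sides nonempty together. *)
have flip u r x : D u r -> K (u + x) -> exists v s, D v s /\ K (v - x).
  move=> Du /cp [d d0 Kd].
  (* [p - d (u + x)] is in [K]; divided by [d] it is [v - x]. *)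
  exists (d^-1 *: p - u), (d^-1 * q - r); split.
    by have := linD (-1) _ _ _ _ Du (DZ d^-1 _ _ Dp);
      rewrite scaleN1r mulN1r ![- _ + _]addrC.
  have := KZ d^-1 _ (ltW _) Kd; rewrite invr_gt0 => /(_ d0).
  by rewrite scalerBr scalerA mulVf ?gt_eqF // scale1r opprD addrA.
pose E := [set - r | r in [set r | exists2 u, D u r & K (u + e)]].
have Eub v s : D v s -> K (v - e) -> ubound E s.
  move=> Dv Kv _ [r [u Du Ku] <-]; rewrite lerNl -subr_ge0 opprK.
  apply: (posD (u + v)); first exact: DD.
  by have := KD _ _ Ku Kv; rewrite addrACA subrr addr0.
(* If [E] is empty, [flip] excludes upper bounds as well, so only [t = 0] occurs and the default
   value of [sup] is harmless. *)
exists (sup E) => _ _ [t [v [s [Dv -> ->]]]] Kv.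
have [t0|t0|t0] := ltgtP t 0; last first.
- by move: Kv; rewrite t0 scale0r mul0r !addr0; apply: posD.
- have Kv' : K (t^-1 *: v + e).
    have := KZ t^-1 _ (ltW _) Kv; rewrite invr_gt0 => /(_ t0).
    by rewrite scalerDr scalerA mulVf ?gt_eqF // scale1r.
  have [w [r [Dw Kw]]] := flip _ _ _ (DZ t^-1 _ _ Dv) Kv'.
  have : - (t^-1 * s) <= sup E.
    apply: ub_le_sup; first by exists r; apply: Eub Kw.
    by exists (t^-1 * s) => //; exists (t^-1 *: v) => //; apply: DZ.
  by rewrite -(ler_pM2l t0) mulrN mulrA divff ?gt_eqF // mul1r -subr_ge0 opprK
    addrC.
- have nt0 : 0 < - t by rewrite oppr_gt0.
  have Kv' : K ((- t)^-1 *: v - e).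
    have := KZ (- t)^-1 _ (ltW _) Kv; rewrite invr_gt0 => /(_ nt0).
    by rewrite scalerDr scalerA invrN mulNr mulVf ?lt_eqF // scaleN1r.
  have [w [r [Dw Kw]]] := flip _ _ _ (DZ (- t)^-1 _ _ Dv) Kv'.
  rewrite opprK in Kw.
  have : sup E <= (- t)^-1 * s.
    apply: ge_sup; first by exists (- r), r => //; exists w.
    by apply: Eub Kv'; apply: DZ.
  rewrite -(ler_pM2l nt0) mulrA divff ?gt_eqF // mul1r mulNr.
  by rewrite -subr_ge0 opprK.
Qed.

(** Adjoining the standard basis vectors one at a time makes the domain the whole space; the values
    chosen there are the coordinates of [w]. *)
Theorem positive_extension n (K : set 'cV[R]_n) (D : 'cV[R]_n -> R -> Prop) p q :
  convex_cone K -> linear_graph D -> pos_graph K D -> D p q -> core K p ->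
  exists2 w, dual_cone K w & forall u r, D u r -> r = dot w u.
Proof.
move=> hK linD posD Dp cp.
have ext (es : seq 'cV[R]_n) : exists D', [/\ linear_graph D', pos_graph K D',
    (forall u r, D u r -> D' u r) & {in es, forall e, exists c, D' e c}].
  elim: es => [|e es [D' [linD' posD' DD' Des]]]; first by exists D.
  have [c posc] := extend_graph_pos e hK linD' posD' (DD' _ _ Dp) cp.
  have incl u r : D' u r -> extend_graph D' e c u r.
    by move=> Du; exists 0, u, r; rewrite scale0r mul0r !addr0.
  exists (extend_graph D' e c); split=> //; first exact: extend_graph_linear.
    by move=> u r /DD' /incl.
  move=> f; rewrite inE => /predU1P[->|/Des [d /incl]]; last by exists d.
  have D0 := linear_graph0 linD' (DD' _ _ Dp).
  by exists c, 1, 0, 0; rewrite scale1r mul1r !add0r.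
have [D' [linD' posD' DD' De]] := ext [seq delta_mx i 0 | i <- enum 'I_n].
have [c Dc] : exists c : 'I_n -> R, forall i, D' (delta_mx i 0) (c i).
  have /choice [c ?] : forall i : 'I_n, exists c, D' (delta_mx i 0) c.
    by move=> i; apply: De; apply: map_f; rewrite mem_enum.
  by exists c.
have D0 := linear_graph0 linD' (DD' _ _ Dp).
pose w := \col_i c i.
have Dw x : D' x (dot w x).
  have -> : x = \sum_(i <- index_enum 'I_n) x i 0 *: delta_mx i 0.
    by rewrite [LHS]matrix_sum_delta; apply: eq_bigr => i _; rewrite big_ord1.
  rewrite linear_sum /=; elim: (index_enum _) => [|i s IHs];
    first by rewrite !big_nil.
  by rewrite !big_cons linearZ /= dot_delta mxE; apply: linD'.
exists w => [x Kx|u r /DD' Du]; first exact: posD' (Dw x) Kx.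
have [K0 _ _] := hK.
(* [r] and [dot w u] are both values over [u], so their two differences are values over 0 and hence
   nonnegative. *)
have pos0 s : D' 0 s -> 0 <= s by move=> /posD'; apply.
apply: le_anti; apply/andP; split; rewrite -subr_ge0; apply: pos0.
  by have := linD' (-1) _ _ _ _ Du (Dw u); rewrite scaleN1r addNr mulN1r addrC.
by have := linD' (-1) _ _ _ _ (Dw u) Du; rewrite scaleN1r addNr mulN1r addrC.
Qed.

Lemma bipolar n (K : set 'cV[R]_n) :
  closed_convex_cone K -> dual_cone (dual_cone K) `<=` K.
Proof.
move=> hK w Kw; apply: contrapT => nKw.
have [K0 KZ KD] := closed_convex_coneW hK.
have [_ _ clK] := hK.
have /nbhs_normP [d /= d0 far] : nbhs w (~` K).
  by apply: open_nbhs_nbhs; split=> //; apply: closed_openC.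
pose d2 := d / 2.
have d20 : 0 < d2 by rewrite divr_gt0.
(* [K] minus the cone over the ball of radius [d2] around [w]: a functional
   nonnegative on [C] and equal to 1 at [- w] separates [w] from [K]. *)
pose C : set 'cV[R]_n :=
  [set x | exists t u, [/\ 0 <= t, `|u| <= t * d2 & K (x + t *: w + u)]].
have hC : convex_cone C.
  split=> [|t x t0 [a [u [a0 ua Ku]]]|x y [a [u [a0 ua Ku]]] [b [v [b0 vb Kv]]]].
  - by exists 0, 0; rewrite normr0 mul0r scale0r !addr0.
  - exists (t * a), (t *: u); rewrite mulr_ge0 // normrZ ger0_norm // -mulrA.
    by rewrite ler_wpM2l // -scalerA -!scalerDr; split=> //; apply: KZ.
  - exists (a + b), (u + v); split; first exact: addr_ge0.
      by rewrite mulrDl (le_trans (ler_normD _ _)) // lerD.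
    by rewrite scalerDl [x + y + _]addrACA [X in K X]addrACA; apply: KD.
pose D (u : 'cV[R]_n) r := u = - r *: w.
have Dw : D (- w) 1 by rewrite /D scaleN1r.
have linD : linear_graph D.
  move=> t u r v q -> ->.
  by rewrite /D scalerA -scalerDl opprD mulrN.
(* For [r < 0], having [- r w] in [C] would put [w + u / (t - r)] in [K], at distance at most
   [d2 < d] from [w]. *)
have posD : pos_graph C D.
  move=> _ r -> [t [u [t0 ut Ku]]]; rewrite leNgt; apply/negP => r0.
  have s0 : 0 < t - r by lra.
  apply: (far (w + (t - r)^-1 *: u)).
    rewrite /= opprD addNKr normrN normrZ gtr0_norm ?invr_gt0 //.
    rewrite mulrC ltr_pdivrMr // (le_lt_trans ut) //.
    rewrite (@le_lt_trans _ _ ((t - r) * d2)) //.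
      by rewrite ler_wpM2r ?lerDl ?oppr_ge0 ?ltW.
    by rewrite mulrC ltr_pM2r // /d2; lra.
  have := KZ (t - r)^-1 _ (ltW _) Ku; rewrite invr_gt0 => /(_ s0).
  by rewrite -scalerDl scalerDr scalerA [- r + t]addrC mulVf ?gt_eqF // scale1r.
(* With [t = 1], the ball in [C] absorbs every small step away from [- w]. *)
have cw : core C (- w).
  split=> [|k _].
    by exists 1, 0; rewrite normr0 mul1r scale1r addNr addr0; split=> //; exact: ltW.
  have k1 : 0 < `|k| + 1 by apply: ltr_wpDl.
  exists (d2 / (`|k| + 1)); first by rewrite divr_gt0.
  exists 1, ((d2 / (`|k| + 1)) *: k); split=> //.
    rewrite mul1r normrZ gtr0_norm ?divr_gt0 // -mulrA ger_pMr // mulrC.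
    by rewrite ler_pdivrMr // mul1r lerDl.
  by rewrite scale1r addrAC subrK addNr.
have [x Cx /(_ _ _ Dw)] := positive_extension hC linD posD Dw cw.
rewrite linearN /= => xw.
suff : 0 <= dot w x by rewrite dotC; lra.
apply: Kw => k Kk; apply: Cx.
by exists 0, 0; rewrite normr0 mul0r scale0r !addr0.
Qed.

End PositiveExtension.

(** * Lagrange multipliers for homogeneous systems *)

Section Multipliers.
Context {R : realType}.

Section Projection.
Variables (V : lmodType R) (a : {scalar V}) (x : V).

Definition project_along (v : V) : V := v - a v *: x.

Lemma project_along_linear : linear project_along.
Proof.
move=> t u v; rewrite /project_along linearP /= scalerDl opprD scalerBr scalerA.
by rewrite addrACA.
Qed.

HB.instance Definition _ := GRing.isLinear.Build R V V *:%R
  project_along project_along_linear.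

End Projection.

Lemma multipliers_homogeneous (V : lmodType R) n (K : set 'cV[R]_n) k
    (s : {linear V -> 'cV[R]_n}) (a : 'I_k -> {scalar V}) (f : {scalar V}) v0 :
  convex_cone K -> core K (s v0) -> (forall i, a i v0 <= 0) ->
  (forall v, K (s v) -> (forall i, a i v <= 0) -> f v <= 0) ->
  exists x l, [/\ dual_cone K x, forall i, 0 <= l i
    & forall v, f v = \sum_i l i * a i v - dot x (s v)].
Proof.
move=> hK; elim: k s a f v0 => [|k IHk] s a f v0 cv0 av0 af.
  (* Without inequalities, [- f] read as a relation on the image of [s] is positive on [K]; its
     extension is the multiplier. *)
  pose D u r := exists2 v, u = s v & r = - f v.
  have linD : linear_graph D.
    move=> t _ _ _ _ [u -> ->] [v -> ->]; exists (t *: u + v).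
      by rewrite linearP.
    by rewrite linearP /= opprD mulrN.
  have posD : pos_graph K D.
    by move=> _ _ [v -> ->] /af; rewrite oppr_ge0; apply; case.
  have Dv v : D (s v) (- f v) by exists v.
  have [x Kx xD] := positive_extension hK linD posD (Dv v0) cv0.
  exists x, (fun=> 0); split=> // v.
  by rewrite big_ord0 sub0r -(xD _ _ (Dv v)) opprK.
(* If the first inequality is redundant, its multiplier is 0. *)
have [f0|] := pselect (forall v, K (s v) ->
    (forall i, a (lift ord0 i) v <= 0) -> f v <= 0).
  have [x [l [Kx l0 fE]]] := IHk s (a \o lift ord0) f v0 cv0 (fun i => av0 _) f0.
  exists x, (fun i => oapp l 0 (unlift ord0 i)); split=> // [i|v].
    by case: unlift => /=.
  rewrite big_ord_recl unlift_none mul0r add0r fE; congr (_ - _).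
  by apply: eq_bigr => i _; rewrite liftK.
move=> /existsNP[xb /not_implyP[Kxb /not_implyP[axb /negP]]].
rewrite -ltNge => fxb.
set a0 := a ord0.
(* [xb] meets all other constraints and has [f xb > 0], so it must violate this one. *)
have a0xb : 0 < a0 xb.
  rewrite ltNge; apply/negP => h; move: fxb; rewrite ltNge => /negP; apply.
  by apply: af => // i; case: (unliftP ord0 i) => [j|] ->.
pose x1 := (a0 xb)^-1 *: xb.
have a0x1 : a0 x1 = 1 by rewrite linearZ /= mulVf ?gt_eqF.
have [_ KZ KD] := hK.
have Kx1 : K (s x1) by rewrite linearZ; apply: KZ => //; rewrite invr_ge0 ltW.
have ax1 i : a (lift ord0 i) x1 <= 0.
  by rewrite linearZ /= mulr_ge0_le0 // invr_ge0 ltW.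
have fx1 : 0 < f x1 by rewrite linearZ /= mulr_gt0 // invr_gt0.
pose pi := project_along a0 x1 : {linear V -> V}.
have a0pi v : a0 (pi v) = 0.
  by rewrite /pi /= /project_along linearB linearZ /= a0x1 mulr1 subrr.
have piE v : pi v = v - a0 v *: x1 by [].
have cpi : core K (s (pi v0)).
  rewrite piE -scaleNr linearD linearZ; apply: core_addr => //.
  by apply: KZ => //; rewrite oppr_ge0 av0.
have api i : a (lift ord0 i) (pi v0) <= 0.
  rewrite piE linearB linearZ /= -mulNr -[leRHS]addr0 lerD ?av0 //.
  by rewrite mulr_ge0_le0 // oppr_ge0 av0.
have [] := IHk (s \o pi) (fun i => a (lift ord0 i) \o pi) (f \o pi) (pi v0).
- by rewrite /= piE a0pi scale0r subr0.
- by move=> i; rewrite /= [X in a _ X]piE a0pi scale0r subr0.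
- move=> v /= Kv av; apply: af => // i.
  by case: (unliftP ord0 i) => [j|] ->; rewrite ?a0pi.
move=> x [l [Kx l0 fE]].
(* The multiplier of [a0] is forced by evaluating the desired identity at [x1], where [a0] is 1. All
   three terms of [c] are nonnegative. *)
pose c := f x1 - \sum_i l i * a (lift ord0 i) x1 + dot x (s x1).
have c0 : 0 <= c.
  rewrite addr_ge0 ?Kx // -sumrN addr_ge0 ?(ltW fx1) // sumr_ge0 // => i _.
  by rewrite -mulrN mulr_ge0 // oppr_ge0.
exists x, (fun i => oapp l c (unlift ord0 i)); split=> // [i|v].
  by case: unlift => /=.
rewrite big_ord_recl unlift_none /=.
under eq_bigr do rewrite liftK /=.
have fpi : f (pi v) = f v - a0 v * f x1 by rewrite piE linearB linearZ.
have spi : dot x (s (pi v)) = dot x (s v) - a0 v * dot x (s x1).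
  by rewrite piE linearB linearZ /= linearB /= linearZ.
have apiE : \sum_i l i * a (lift ord0 i) (pi v) = \sum_i l i * a (lift ord0 i) v
    - a0 v * \sum_i l i * a (lift ord0 i) x1.
  rewrite mulr_sumr -sumrB; apply: eq_bigr => i _.
  by rewrite piE linearB linearZ /= mulrBr (mulrCA (l i)).
have := fE v; rewrite /= fpi spi apiE /c -/a0.
lra.
Qed.

(** * Affine systems by homogenization *)

Section Homogenization.
Variables (V U : lmodType R).

(** The second coordinate scales the constant term, so the affine map is the slice at 1. [R^o] is
    [R] as a module over itself. *)
Definition homog (s : V -> U) (s0 : U) (z : V * R^o) : U :=
  s z.1 + (z.2 : R) *: s0.

Lemma homog_linear (s : {linear V -> U}) s0 : linear (homog s s0).
Proof.
move=> t u v; rewrite /homog /= linearP scalerDl scalerDr scalerA.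
by rewrite addrACA.
Qed.

HB.instance Definition _ (s : {linear V -> U}) s0 :=
  GRing.isLinear.Build R (V * R^o)%type U *:%R (homog s s0) (homog_linear s s0).

End Homogenization.

Section ScalarHomogenization.
Variable V : lmodType R.

Definition homogs (f : V -> R) (f0 : R) (z : V * R^o) : R :=
  f z.1 + (z.2 : R) * f0.

Lemma homogs_scalar (f : {scalar V}) f0 : scalar (homogs f f0).
Proof.
move=> t u v; rewrite /homogs /= linearP mulrDl mulrDr mulrA.
by rewrite addrACA.
Qed.

HB.instance Definition _ (f : {scalar V}) f0 :=
  GRing.isLinear.Build R (V * R^o)%type R *%R (homogs f f0) (homogs_scalar f f0).

End ScalarHomogenization.

(** The homogenized system in [(v, t)] has the extra inequality [- t <= 0], stored at index [ord0].
    Its multiplier becomes the slack in the final bound on [f0]. *)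
Theorem multipliers_affine (V : lmodType R) n (K : set 'cV[R]_n) k
    (s : {linear V -> 'cV[R]_n}) s0 (a : 'I_k -> {scalar V}) (a0 : 'I_k -> R)
    (f : {scalar V}) f0 v0 :
  convex_cone K -> core K (s v0 + s0) -> (forall i, a i v0 + a0 i <= 0) ->
  (forall v, K (s v + s0) -> (forall i, a i v + a0 i <= 0) -> f v + f0 <= 0) ->
  exists x l, [/\ dual_cone K x, forall i, 0 <= l i,
    forall v, f v = \sum_i l i * a i v - dot x (s v)
    & f0 <= \sum_i l i * a0 i - dot x s0].
Proof.
move=> hK cv0 av0 af.
have [_ KZ KD] := hK.
have hom v (t : R) : 0 <= t -> K (s v + t *: s0) ->
    (forall i, a i v + t * a0 i <= 0) -> f v + t * f0 <= 0.
  move=> t0 Kv bv.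
  have [t00|tn0] := eqVneq t 0; last first.
    have tp : 0 < t by rewrite lt_def tn0.
    rewrite -(pmulr_rle0 _ (_ : 0 < t^-1)) ?invr_gt0 // mulrDr mulrA mulVf //.
    rewrite mul1r -[_ * f v]linearZ; apply: af => [|i].
      have := KZ t^-1 _ _ Kv; rewrite invr_ge0 => /(_ t0).
      by rewrite scalerDr scalerA mulVf // scale1r linearZ.
    rewrite linearZ /= -(pmulr_rle0 _ tp) mulrDr mulrA divff // mul1r.
    exact: bv.
  (* At [t = 0] the point [v] is a recession direction of the feasible set. *)
  have {}Kv : K (s v) by move: Kv; rewrite t00 scale0r addr0.
  have {}bv i : a i v <= 0 by have := bv i; rewrite t00 mul0r addr0.
  rewrite t00 mul0r addr0 leNgt; apply/negP => fv.
  (* Moving [N] steps along [v] raises [f v0 + f0] by its absolute value plus 1, hence above 0. *)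
  pose N := (`|f v0 + f0| + 1) / f v.
  have N0 : 0 <= N by rewrite divr_ge0 ?addr_ge0 // ltW.
  have : f (v0 + N *: v) + f0 <= 0.
    apply: af => [|i].
      rewrite linearD linearZ /= addrAC; apply: KD; first by case: cv0.
      exact: KZ.
    rewrite linearD linearZ /= addrAC -[leRHS]addr0 lerD //.
    exact: mulr_ge0_le0.
  rewrite linearD linearZ /= /N divfK ?gt_eqF // addrAC leNgt => /negP; apply.
  by have := ler_norm (- (f v0 + f0)); rewrite normrN; lra.
pose b (i : 'I_k.+1) : {scalar (V * R^o)%type} :=
  if unlift ord0 i is Some j then homogs (a j) (a0 j)
  else homogs (GRing.null_fun _ : {scalar V}) (-1).
have b0 z : b ord0 z = - z.2.
  by rewrite /b unlift_none /= /homogs /= add0r mulrN1.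
have bS i z : b (lift ord0 i) z = a i z.1 + z.2 * a0 i by rewrite /b liftK.
have [] := @multipliers_homogeneous _ n K _ (homog s s0) b (homogs f f0)
  (v0, 1) hK.
- by rewrite /= /homog /= scale1r.
- move=> i; case: (unliftP ord0 i) => [j|] ->; first by rewrite bS mul1r.
  by rewrite b0 /= lerN10.
- move=> [v t] /= Kv bv; apply: hom => // [|i].
    by have := bv ord0; rewrite b0 oppr_le0.
  by have := bv (lift ord0 i); rewrite bS.
move=> x [l [Kx l0 fE]].
exists x, (l \o lift ord0); split=> // [i|v|].
- exact: l0.
- have := fE (v, (0 : R)); rewrite /= /homogs /homog /= mul0r addr0
    scale0r addr0 => ->.
  rewrite big_ord_recl b0 oppr0 mulr0 add0r; congr (_ - _).
  by apply: eq_bigr => i _; rewrite bS mul0r addr0.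
(* At [(0, 1)] the identity expresses [f0] exactly; dropping the term [- l ord0 <= 0] leaves the
   bound. *)
- have := fE (0, (1 : R)); rewrite /= /homogs /homog /= !linear0 mul1r add0r
    scale1r add0r => ->.
  rewrite big_ord_recl b0 mulrN1 lerB // -[leRHS]add0r lerD ?oppr_le0 //.
  by apply: ler_sum => i _; rewrite bS linear0 mul1r add0r.
Qed.

End Multipliers.

(** * Polyhedral cones and their duals *)

Section Duality.
Context {R : realType}.

(** The conic constraint is placed in the zero-dimensional space, so only the multipliers of the
    rows of [B] remain. *)
Lemma farkas n k (B : 'M[R]_(k, n)) (x : 'cV[R]_n) :
  dual_cone [set z | forall i, (B *m z) i 0 <= 0] x ->
  exists2 u : 'cV[R]_k, (forall i, 0 <= u i 0) & x = - (B^T *m u).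
Proof.
move=> Bx.
have rowE i v : dot (row i B)^T v = (B *m v) i 0.
  by rewrite [RHS]mxE; apply: eq_bigr => j _; rewrite !mxE.
have hT : convex_cone (setT : set 'cV[R]_0) by [].
have cT : core (setT : set 'cV[R]_0) 0 by split=> // ? _; exists 1.
have [|v _ av|w [l [_ l0 lE]]] := @multipliers_homogeneous _ _ 0 setT k
  (GRing.null_fun _ : {linear 'cV[R]_n -> 'cV[R]_0})
  (fun i => dot (row i B)^T : {scalar 'cV[R]_n})
  (dot (- x) : {scalar 'cV[R]_n}) 0 hT cT.
- by move=> i; rewrite linear0.
- by rewrite /= dotNl oppr_le0; apply: Bx => i; rewrite /= -rowE; apply: av.
exists (\col_i l i) => [i|]; first by rewrite mxE.
apply: dot_inj => v; rewrite dotNl dot_mulmx -[LHS]opprK -(dotNl x) lE /=.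
rewrite linear0 subr0; congr (- _); apply: eq_bigr => i _.
by rewrite rowE mxE.
Qed.

(** Since 0 is in [K], [d >= 0]. If some [(B x)_i] were positive, a multiple of [x] would reach the
    value [d_i + 1]. *)
Lemma polyhedral_coneP n (K : set 'cV[R]_n) :
  convex_cone K -> polyhedral K ->
  exists k (B : 'M[R]_(k, n)), K = [set x | forall i, (B *m x) i 0 <= 0].
Proof.
move=> [K0 KZ _] [k [B [d KE]]]; exists k, B; rewrite KE in K0 KZ *.
have d0 i : 0 <= d i 0 by have := K0 i; rewrite mulmx0 mxE.
apply/seteqP; split=> x Kx i; last exact: le_trans (Kx i) (d0 i).
rewrite leNgt; apply/negP => Bx.
have := KZ ((d i 0 + 1) / (B *m x) i 0) x;
  rewrite divr_ge0 ?addr_ge0 ?(ltW Bx) //.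
move=> /(_ isT Kx i); rewrite -scalemxAr mxE divfK ?gt_eqF // => dd.
by move: dd; rewrite gerDl ler10.
Qed.

Lemma dual_cone_prod n1 n2 (K1 : set 'cV[R]_n1) (K2 : set 'cV[R]_n2) :
  K1 0 -> K2 0 ->
  dual_cone (cone_prod K1 K2) = cone_prod (dual_cone K1) (dual_cone K2).
Proof.
move=> K10 K20; apply/seteqP; split=> x.
  rewrite -[x]vsubmxK => Kx; split=> z Kz; rewrite ?col_mxKu ?col_mxKd.
    have := Kx (col_mx z 0); rewrite dot_col_mx col_mxKu col_mxKd linear0 addr0.
    by apply; split; rewrite ?col_mxKu ?col_mxKd.
  have := Kx (col_mx 0 z); rewrite dot_col_mx col_mxKu col_mxKd linear0 add0r.
  by apply; split; rewrite ?col_mxKu ?col_mxKd.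
move=> [x1 x2] z [z1 z2]; rewrite -[x]vsubmxK dot_col_mx.
by rewrite addr_ge0 ?x1 ?x2.
Qed.

(** * Weak duality and multipliers for the primal-dual pair *)

Section Pair.
Variables (n1 n2 m : nat).
Variables (A : {linear 'cV[R]_(n1 + n2) -> 'cV[R]_m}).
Variables (Astar : {linear 'cV[R]_m -> 'cV[R]_(n1 + n2)}).
Variables (b : 'cV[R]_m) (c : 'cV[R]_(n1 + n2)).
Variables (K1 : set 'cV[R]_n1) (K2 : set 'cV[R]_n2).
Hypotheses (hA : is_adjoint A Astar) (hK1 : closed_convex_cone K1).
Hypotheses (hK2 : closed_convex_cone K2) (hK2poly : polyhedral K2).

Let K := cone_prod K1 K2.

(** The gap is the pairing of [x] with the slack [c - Astar y]. *)
Lemma weak_duality x y :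
  primal_feasible A b K x -> dual_feasible Astar c K y -> dot b y <= dot c x.
Proof.
move=> [<- Kx] Ky; rewrite hA -subr_ge0 [dot c x]dotC -linearB.
exact: Kx.
Qed.

Lemma thetaD_le_thetaP : (thetaD Astar b c K <= thetaP A b c K)%E.
Proof.
apply: ge_ereal_sup => _ [y Ky <-]; apply: le_ereal_inf_tmp => _ [x Kx <-].
by rewrite lee_fin; apply: weak_duality.
Qed.

(** The unknowns are [(x1, u)] with [u >= 0], standing for [x = T (x1, u)]. The cone is
    [dual_cone K1] times [[set 0]], the second factor encoding [A x = b]; the multiplier of that
    equation is the dual solution. *)
Lemma dual_multiplier th : primal_PPS A b K1 K2 ->
  (forall x, primal_feasible A b K x -> th <= dot c x) ->
  exists2 y, dual_feasible Astar c K y & th <= dot b y.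
Proof.
have c1 := closed_convex_coneW hK1; have c2 := closed_convex_coneW hK2.
have [K10 _ _] := c1; have [K20 _ _] := c2.
have [k [B K2E]] := polyhedral_coneP c2 hK2poly.
move=> [x0 [Ax0 Kx0] x0ri] thle.
rewrite dual_cone_prod // in Kx0; case: Kx0 => [_].
rewrite K2E => /farkas [u0 u00 u0E].
pose V : lmodType R := ('cV[R]_n1 * 'cV[R]_k)%type.
pose T (z : V) := col_mx z.1 (- (B^T *m z.2)).
have linT : linear T.
  move=> t u v; rewrite /T /= mulmxDr -scalemxAr opprD -scalerN.
  by rewrite scale_col_mx add_col_mx.
pose TL : {linear V -> 'cV[R]_(n1 + n2)} :=
  HB.pack T (GRing.isLinear.Build _ _ _ _ T linT).
pose s (z : V) := col_mx z.1 (A (T z)).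
have lins : linear s.
  by move=> t u v; rewrite /s linT (linearP A) scale_col_mx add_col_mx.
pose sL : {linear V -> 'cV[R]_(n1 + m)} :=
  HB.pack s (GRing.isLinear.Build _ _ _ _ s lins).
have scala i : scalar (fun z : V => - z.2 i 0).
  by move=> t u v; rewrite !mxE opprD mulrN.
pose aL i : {scalar V} :=
  HB.pack (fun z : V => - z.2 i 0) (GRing.isLinear.Build _ _ _ _ _ (scala i)).
have sE z : sL z + col_mx 0 (- b) = col_mx z.1 (A (T z) - b).
  by rewrite /= /s add_col_mx addr0.
have [||||w [l [Kw l0 fE thw]]] := @multipliers_affine _ V _
    (cone_prod (dual_cone K1) [set 0]) k sL (col_mx 0 (- b)) aL (fun=> 0)
    (dot (- c) \o TL : {scalar V}) th (usubmx x0, u0).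
- apply: cone_prod_convex; first exact: dual_convex_cone.
  split=> [//|t x _ ->|x y -> ->]; by rewrite ?scaler0 ?addr0.
- rewrite sE /T /= -u0E vsubmxK Ax0 subrr.
  apply: core_cone_prod_set0; rewrite ?col_mxKu ?col_mxKd //.
  by apply: ri_core => //; exact: dual_convex_cone.
- by move=> i; rewrite /= addr0 oppr_le0.
- move=> z; rewrite sE => -[]; rewrite /= col_mxKu col_mxKd => Kz1 /eqP.
  rewrite subr_eq0 => /eqP Az az; rewrite dotNl addrC subr_le0.
  apply: thle; split=> //; rewrite dual_cone_prod //.
  split; rewrite /T ?col_mxKu ?col_mxKd //.
  rewrite K2E => v Bv; rewrite dotNl dot_mulmx -linearN /= sumr_ge0 // => i _.
  have z2 : 0 <= z.2 i 0 by have := az i; rewrite /= addr0 oppr_le0.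
  by rewrite mulr_ge0 // [leRHS]mxE oppr_ge0; apply: Bv.
pose y := dsubmx w.
have wE p q : dot w (col_mx p q) = dot (usubmx w) p + dot y q.
  by rewrite -[w in LHS]vsubmxK dot_col_mx col_mxKu col_mxKd.
exists y; last first.
  move: thw; rewrite big1 => [|i _]; last by rewrite mulr0.
  by rewrite wE linear0 !add0r linearN opprK dotC.
have K1w : K1 (usubmx w).
  apply: bipolar => // p Kp.
  have := Kw (col_mx p 0); rewrite wE linear0 addr0.
  by apply; split; rewrite /= ?col_mxKu ?col_mxKd.
pose d := c - Astar y.
(* The multiplier identity says what the slack [d] does on the range of [T]. Taking [u = 0] gives
   its first block as [usubmx w]; taking [x = 0] and a unit vector [u] gives [- (B d2)_i = l_i >= 0]
   for its second block [d2]. *)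
have dE x u : dot (usubmx d) x - dot (dsubmx d) (B^T *m u)
    = \sum_i l i * u i 0 + dot (usubmx w) x.
  have := fE (x, u); rewrite /= /s wE.
  under eq_bigr do rewrite mulrN.
  rewrite sumrN dotNl [dot y _]dotC hA [dot (T _) _]dotC => e.
  have : dot d (T (x, u)) = \sum_i l i * u i 0 + dot (usubmx w) x.
    by rewrite dotDl dotNl; lra.
  by rewrite -[d in dot d]vsubmxK dot_col_mx !col_mxKu col_mxKd linearN.
split; rewrite -/d.
  have -> : usubmx d = usubmx w.
    apply: dot_inj => x; have := dE x 0.
    rewrite mulmx0 linear0 subr0 => ->; rewrite big1 ?add0r // => i _.
    by rewrite mxE mulr0.
  exact: K1w.
rewrite K2E => i; have := dE 0 (delta_mx i 0).
rewrite !linear0 sub0r addr0 [dot _ (B^T *m _)]dotC dot_mulmx.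
rewrite [dot (delta_mx _ _) _]dotC dot_delta.
rewrite (bigD1 i) //= big1 => [|j ji]; last by rewrite mxE (negbTE ji) mulr0.
by rewrite [delta_mx _ _ _ _]mxE !eqxx mulr1 addr0 /= -oppr_ge0 => ->.
Qed.

(** In the variable [y], the slack has its first block in [K1] and its second block satisfies
    finitely many inequalities. The multipliers form [x], and the identity in [y] becomes
    [A x = b]. *)
Lemma primal_multiplier th : dual_PPS Astar c K1 K2 ->
  (forall y, dual_feasible Astar c K y -> dot b y <= th) ->
  exists2 x, primal_feasible A b K x & dot c x <= th.
Proof.
have c1 := closed_convex_coneW hK1; have c2 := closed_convex_coneW hK2.
have [K10 _ _] := c1; have [K20 _ _] := c2.
have [k [B K2E]] := polyhedral_coneP c2 hK2poly.
move=> [y0 [y0ri Ky0]] leth.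
pose s y := - usubmx (Astar y).
have lins : linear s.
  by move=> t u v; rewrite /s (linearP Astar) (linearP usubmx) opprD -scalerN.
pose sL : {linear 'cV[R]_m -> 'cV[R]_n1} :=
  HB.pack s (GRing.isLinear.Build _ _ _ _ s lins).
pose a i y := - (B *m dsubmx (Astar y)) i 0.
have scala i : scalar (a i).
  by move=> t u v; rewrite /a (linearP Astar) (linearP dsubmx)
    (linearP (mulmx B)) !mxE opprD mulrN.
pose aL i : {scalar 'cV[R]_m} :=
  HB.pack (a i) (GRing.isLinear.Build _ _ _ _ (a i) (scala i)).
have sE y : sL y + usubmx c = usubmx (c - Astar y).
  by rewrite linearB addrC.
have aE i y : aL i y + (B *m dsubmx c) i 0 = (B *m dsubmx (c - Astar y)) i 0.
  by rewrite (linearB dsubmx) (linearB (mulmx B)) /= addrC [RHS]mxE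
    [X in _ = _ + X]mxE.
have [|i|y Ky ay|x1 [l [Kx1 l0 bE thx]]] := @multipliers_affine _ _ _ K1 k sL
  (usubmx c) aL (fun i => (B *m dsubmx c) i 0) (dot b) (- th) y0 c1.
- by rewrite sE; apply: ri_core.
- by rewrite aE; move: Ky0; rewrite K2E; apply.
- rewrite subr_le0; apply: leth; split; first by rewrite -sE.
  by rewrite K2E => i; rewrite /= -aE.
pose L : 'cV[R]_k := \col_i l i.
have LE z : \sum_i l i * (B *m z) i 0 = dot L (B *m z).
  by apply: eq_bigr => i _; rewrite [L i 0]mxE.
(* As in Farkas' lemma, nonnegative row multipliers [L] give the element [- B^T L] of the dual of
   [K2]. *)
pose x := col_mx x1 (- (B^T *m L)).
exists x; last first.
  move: thx; rewrite LE [dot c x]dotC dot_col_mx dotNl dot_mulmx; lra.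
split.
  apply: dot_inj => y; rewrite hA dot_col_mx dotNl dot_mulmx bE /= -LE.
  under [X in _ = X - _]eq_bigr do rewrite mulrN.
  by rewrite sumrN linearN opprK addrC.
rewrite dual_cone_prod //; split; rewrite /x ?col_mxKu ?col_mxKd //.
rewrite K2E => z Bz; rewrite dotNl dot_mulmx -linearN /= sumr_ge0 // => i _.
rewrite mulr_ge0 //; first by rewrite mxE.
by rewrite [leRHS]mxE oppr_ge0; apply: Bz.
Qed.

End Pair.
End Duality.

(** * Strong duality with attainment *)

Theorem proposition2 (R : realType) (n1 n2 m : nat)
    (A : {linear 'cV[R]_(n1 + n2) -> 'cV[R]_m})
    (Astar : {linear 'cV[R]_m -> 'cV[R]_(n1 + n2)})
    (b : 'cV[R]_m) (c : 'cV[R]_(n1 + n2))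
    (K1 : set 'cV[R]_n1) (K2 : set 'cV[R]_n2)
    (hA : is_adjoint A Astar)
    (hK1 : closed_convex_cone K1) (hK2 : closed_convex_cone K2)
    (hK2poly : polyhedral K2) :
  let K := cone_prod K1 K2 in
  (thetaP A b c K \is a fin_num -> primal_PPS A b K1 K2 ->
     thetaP A b c K = thetaD Astar b c K /\ dual_attained Astar b c K) /\
  (thetaD Astar b c K \is a fin_num -> dual_PPS Astar c K1 K2 ->
     thetaP A b c K = thetaD Astar b c K /\ primal_attained A b c K).
Proof.
move=> K; have DP := @thetaD_le_thetaP R n1 n2 m A Astar b c K1 K2 hA.
split=> fin pps.
  (* Finiteness allows the optimal value itself as the bound [th]; weak duality then turns all
     inequalities into equalities. *)
  have [|y Ky le_y] := dual_multiplier (th := fine (thetaP A b c K))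
    hA hK1 hK2 hK2poly pps (c := c).
    by move=> x Kx; rewrite -lee_fin fineK //; apply: ereal_inf_lbound; exists x.
  have PD : (thetaP A b c K <= (dot b y)%:E)%E by rewrite -(fineK fin) lee_fin.
  have yD : ((dot b y)%:E <= thetaD Astar b c K)%E.
    by apply: ereal_sup_ubound; exists y.
  split; first by apply: le_anti; rewrite DP (le_trans PD yD).
  by exists y => //; apply: le_anti; rewrite yD (le_trans DP PD).
have [|x Kx le_x] := primal_multiplier (th := fine (thetaD Astar b c K))
  hA hK1 hK2 hK2poly pps (b := b).
  by move=> y Ky; rewrite -lee_fin fineK //; apply: ereal_sup_ubound; exists y.
have xD : ((dot c x)%:E <= thetaD Astar b c K)%E by rewrite -(fineK fin) lee_fin.
have Px : (thetaP A b c K <= (dot c x)%:E)%E.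
  by apply: ereal_inf_lbound; exists x.
split; first by apply: le_anti; rewrite DP (le_trans Px xD).
by exists x => //; apply: le_anti; rewrite Px (le_trans xD DP).
Qed.
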